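(* Let $\mathcal M$ be (the set of covectors of) a sweep oriented matroid on the ground set $\binom{[n]}{2}$. Then \[\mathcal B(\mathcal M)=\{X^k : X\in\mathcal M,\ 1\le k\le 2l_X+1\}\subseteq\{+,-,0\}^{[n]\cup\binom{[n]}{2}}\] is the set of covectors of an oriented matroid on $[n]\cup\binom{[n]}{2}$.
   Context: Sign vectors: for $X\in\{+,-,0\}^E$, $-X$ switches $+$ and $-$; the composition is $(X\circ Y)_e=X_e$ if $X_e\neq0$ and $Y_e$ otherwise; the separation set is $S(X,Y)=\{e: \{X_e,Y_e\}=\{+,-\}\}$. An oriented matroid on $E$ is a set $\mathcal L\subseteq\{+,-,0\}^E$ (its covectors) with: (V0) $0\in\mathcal L$; (V1) $X\in\mathcal L\Rightarrow -X\in\mathcal L$; (V2) $X,Y\in\mathcal L\Rightarrow X\circ Y\in\mathcal L$; (V3) if $X,Y\in\mathcal L$ and $e\in S(X,Y)$ there is $Z\in\mathcal L$ with $Z_e=0$ and $Z_f=(X\circ Y)_f$ for all $f\notin S(X,Y)$. $\binom{[n]}{2}$ denotes the set of pairs $(i,j)$ with $1\le i<j\le n$. An ordered partition $I=(I_1,\dots,I_l)$ of $[n]$ (nonempty disjoint blocks with union $[n]$) corresponds to the surjection $p_I:[n]\to[l]$ with $p_I(i)=k$ iff $i\in I_k$; its sign vector $X^I\in\{+,-,0\}^{\binom{[n]}{2}}$ has $X^I_{(i,j)}=+,-,0$ according as $p_I(i)<p_I(j)$, $p_I(i)>p_I(j)$, $p_I(i)=p_I(j)$. The braid oriented matroid $\mathcal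 A_n$ is the oriented matroid on $\binom{[n]}{2}$ whose covectors are exactly the $X^I$ for all ordered partitions $I$ of $[n]$ (the oriented matroid of the vectors $e_j-e_i$). A sweep oriented matroid is an oriented matroid on $\binom{[n]}{2}$ every covector of which is a covector of $\mathcal A_n$. For a covector $X$ of a sweep oriented matroid, $I_X$ is the ordered partition with $X=X^{I_X}$, $l_X$ its number of blocks and $p_X=p_{I_X}$. For $1\le k\le 2l_X+1$, $X^k\in\{+,-,0\}^{[n]\cup\binom{[n]}{2}}$ is defined by $X^k_{(i,j)}=X_{(i,j)}$ and, for $i\in[n]$: $X^k_i=-$ if $p_X(i)\le\lfloor\frac{k-1}{2}\rfloor$; $X^k_i=+$ if $p_X(i)>\lfloor\frac k2\rfloor$; $X^k_i=0$ if $k$ is even and $p_X(i)=\frac k2$. *)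

(* Defs.v *)
From HB Require Import structures.
From mathcomp Require Import all_boot.

Set Implicit Arguments.
Unset Strict Implicit.
Unset Printing Implicit Defensive.

Inductive sign := Neg | Zero | Pos.

Definition sign_code (s : sign) : option bool :=
  match s with Neg => Some false | Zero => None | Pos => Some true end.
Definition sign_decode (c : option bool) : sign :=
  match c with Some false => Neg | None => Zero | Some true => Pos end.
Lemma sign_codeK : cancel sign_code sign_decode. Proof. by case. Qed.
HB.instance Definition _ := Finite.copy sign (can_type sign_codeK).

Definition sign_opp (s : sign) : sign :=
  match s with Neg => Pos | Zero => Zero | Pos => Neg end.

Notation signvec E := {ffun E -> sign}.

Definition sv_zero (E : finType) : signvec E := [ffun=> Zero].

Definition sv_opp (E : finType) (X : signvec E) : signvec E :=
  [ffun e => sign_opp (X e)].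

Definition sv_comp (E : finType) (X Y : signvec E) : signvec E :=
  [ffun e => if X e != Zero then X e else Y e].

Definition sv_sep (E : finType) (X Y : signvec E) : {set E} :=
  [set e | ((X e == Pos) && (Y e == Neg)) || ((X e == Neg) && (Y e == Pos))].

(* Sets of sign vectors are Prop-valued predicates; [L X] reads "X is in L". *)
Record oriented_matroid (E : finType) (L : signvec E -> Prop) : Prop := {
  om_zero : L (sv_zero E);
  om_opp : forall X, L X -> L (sv_opp X);
  om_comp : forall X Y, L X -> L Y -> L (sv_comp X Y);
  om_elim : forall X Y e, L X -> L Y -> e \in sv_sep X Y ->
    exists Z, [/\ L Z, Z e = Zero &
      forall f, f \notin sv_sep X Y -> Z f = sv_comp X Y f]
}.

(* [n] is 'I_n, so its elements are shifted to 0, ..., n - 1. *)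
Definition pairs (n : nat) : finType :=
  {ij : 'I_n * 'I_n | ij.1 < ij.2}.

(* I = [:: I_1; ...; I_l]; [uniq] and [partition] together make the entries of
   the list nonempty and disjoint, with union [n]. *)
Definition ordered_partition (n : nat) (I : seq {set 'I_n}) : bool :=
  uniq I && partition [set B in I] [set: 'I_n].

(* p_I, with blocks numbered from 1. *)
Definition block_index (n : nat) (I : seq {set 'I_n}) (i : 'I_n) : nat :=
  (find (fun B : {set 'I_n} => i \in B) I).+1.

Definition partition_sv (n : nat) (I : seq {set 'I_n}) : signvec (pairs n) :=
  [ffun ij : pairs n =>
     let a := block_index I (val ij).1 in
     let b := block_index I (val ij).2 in
     if a < b then Pos else if b < a then Neg else Zero].

Definition braid (n : nat) (X : signvec (pairs n)) : Prop :=
  exists2 I : seq {set 'I_n}, ordered_partition I & X = partition_sv I.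

Definition sweep_oriented_matroid (n : nat) (M : signvec (pairs n) -> Prop) :
    Prop :=
  oriented_matroid M /\ forall X, M X -> braid X.

(* X^k, where I is the ordered partition I_X. *)
Definition big_sv (n : nat) (X : signvec (pairs n)) (I : seq {set 'I_n})
    (k : nat) : signvec ('I_n + pairs n)%type :=
  [ffun e => match e with
     | inl i => if block_index I i <= k.-1./2 then Neg
                else if k./2 < block_index I i then Pos
                else Zero
     | inr ij => X ij
     end].

(* The remaining case of [big_sv] is the one where k is even and
   p_X(i) = k / 2. *)
Lemma big_sv_inl0 (n : nat) (X : signvec (pairs n)) (I : seq {set 'I_n})
    (k : nat) (i : 'I_n) : 0 < k ->
  (big_sv X I k (inl i) = Zero) <-> (~~ odd k /\ block_index I i = k./2).
Proof.
case: k => // k _; rewrite ffunE succnK /= uphalf_half negbK.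
case: (leqP (block_index I i) k./2) => [le1|lt1].
  by split=> // -[ok eqk]; move: le1; rewrite eqk ok ltnn.
case: ltnP => [lt2|le2].
  by split=> // -[_ eqk]; move: lt2; rewrite eqk ltnn.
split=> // _; case: (odd k) le2 => le2; last by move: (leq_trans lt1 le2); rewrite ltnn.
by split=> //; apply/eqP; rewrite eqn_leq le2.
Qed.

(* B(M). The ordered partition I is determined by X = X^I, so it is I_X and
   [size I] is l_X. *)
Definition big_om (n : nat) (M : signvec (pairs n) -> Prop)
    (Y : signvec ('I_n + pairs n)%type) : Prop :=
  exists (X : signvec (pairs n)) (I : seq {set 'I_n}) (k : nat),
    [/\ M X, ordered_partition I, X = partition_sv I,
        1 <= k <= (size I).*2.+1 & Y = big_sv X I k].

(* Main.v *)
Require Import Defs.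
From mathcomp Require Import all_boot.

(** Reading a cut of an ordered partition of [n] as the position of an extra
    point, B(M) consists of the sign vectors whose restriction x to the pairs
    lies in M and whose vertex signs are compatible with x on every pair; this
    local condition is visibly stable under negation and composition.

    Elimination of a pair is done in M.  On the vertices that do not separate X
    and Y, the signs of X o Y are compatible with the result, and a compatible
    partial assignment of vertex signs always extends to a cut.

    To eliminate a vertex i with X_i = + and Y_i = -, it suffices to find z in M
    that agrees with X o Y off S(X, Y) and satisfies z_(i,j) = (X o Y)_j for all
    vertices j outside S(X, Y): the cut through the block of i is then a
    solution.  If X_j = Y_j = 0 for some j, eliminating (i,j) in M gives z.
    Otherwise start with z = Y, which is right on all j with (X o Y)_j = +, and
    repair the j with (X o Y)_j = - one by one: eliminate (i,j) between z and X
    and compose with X. *)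

Set Implicit Arguments.
Unset Strict Implicit.
Unset Printing Implicit Defensive.

(** * Compatibility of the sign of a pair with the signs of its two vertices *)

Definition sign_comp (a b : sign) : sign := if a != Zero then a else b.

Definition sign_sep (a b : sign) : bool :=
  ((a == Pos) && (b == Neg)) || ((a == Neg) && (b == Pos)).

Definition sign_cmp (a b : nat) : sign :=
  if a < b then Pos else if b < a then Neg else Zero.

(* [s] is the sign of a pair (i, j), [a] and [b] are the signs of i and j. *)
Definition compat (s a b : sign) : bool :=
  match s with
  | Pos => (a == Neg) || (b == Pos)
  | Neg => (a == Pos) || (b == Neg)
  | Zero => a == b
  end.

Lemma sign_compC a b : ~~ sign_sep a b -> sign_comp a b = sign_comp b a.
Proof. by case: a; case: b. Qed.

Lemma sign_sepC a b : sign_sep a b = sign_sep b a.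
Proof. by case: a; case: b. Qed.

Lemma compat_opp s a b :
  compat s a b -> compat (sign_opp s) (sign_opp a) (sign_opp b).
Proof. by case: s; case: a; case: b. Qed.

Lemma compat_comp s a b s' a' b' : compat s a b -> compat s' a' b' ->
  compat (sign_comp s s') (sign_comp a a') (sign_comp b b').
Proof. by case: s; case: a; case: b => //; case: s'; case: a'; case: b'. Qed.

(** If [s] and [s'] are opposite, [t] is arbitrary, but then both compositions are the same nonzero
    sign, and this is compatible with every [t]. *)
Lemma compat_elim s a b s' a' b' t : compat s a b -> compat s' a' b' ->
    ~~ sign_sep a a' -> ~~ sign_sep b b' ->
    (~~ sign_sep s s' -> t = sign_comp s s') ->
  compat t (sign_comp a a') (sign_comp b b').
Proof.
case: s; case: a; case: b => //; case: s'; case: a'; case: b' => //= _ _ _ _;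
  by [move=> -> | case: t].
Qed.

Lemma sign_cmp_opp a b : sign_cmp b a = sign_opp (sign_cmp a b).
Proof. by rewrite /sign_cmp; case: ltngtP. Qed.

Lemma compat_cmp a b c : compat (sign_cmp a b) (sign_cmp c a) (sign_cmp c b).
Proof.
rewrite /sign_cmp; case: (ltngtP a b) => [ab|ba|->] /=; last by rewrite eqxx.
- case: (ltngtP c a) => [ca| |->] //=; last by rewrite ab.
  by rewrite (ltn_trans ca ab).
- case: (ltngtP c b) => [cb| |->] //=; rewrite ?orbT //; last by rewrite ba.
  by rewrite (ltn_trans cb ba).
Qed.

(** The bound on [m'] leaves at most one value, [m.+1], with sign 0, so two vertices of sign 0 lie
    in the same block. *)
Lemma compat_cut a b m m' : m' <= m.+1 ->
  compat (sign_cmp a b)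
    (if a <= m then Neg else if m' < a then Pos else Zero)
    (if b <= m then Neg else if m' < b then Pos else Zero).
Proof.
have cutP c d : c < d -> m' <= m.+1 -> m < c -> (d <= m) = false /\ m' < d.
  move=> cd mm mc; have md := leq_ltn_trans mc cd.
  by rewrite leqNgt (ltnW md); split=> //; exact: leq_ltn_trans mm md.
rewrite /sign_cmp => mm; case: (ltngtP a b) => [ab|ba|->] //=.
- by case: (leqP a m) => //= ma; have [-> ->] := cutP _ _ ab mm ma; rewrite orbT.
- case: (leqP b m) => //= mb; first by rewrite orbT.
  by have [-> ->] := cutP _ _ ba mm mb.
Qed.

(** * Sign vectors on all ordered pairs, and agreement with X o Y off S(X, Y) *)

Section FullSign.

Variable n : nat.
Implicit Types (X Y Z : signvec (pairs n)) (i j k : 'I_n).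

(* The antisymmetric extension of X from the pairs i < j to all (i, j). *)
Definition full_sv X i j : sign :=
  match insub (i, j) : option (pairs n), insub (j, i) : option (pairs n) with
  | Some e, _ => X e
  | _, Some e => sign_opp (X e)
  | _, _ => Zero
  end.

Lemma full_svE X (e : pairs n) : full_sv X (val e).1 (val e).2 = X e.
Proof. by rewrite /full_sv -surjective_pairing valK. Qed.

Lemma full_sv_comp X Y i j :
  full_sv (sv_comp X Y) i j = sign_comp (full_sv X i j) (full_sv Y i j).
Proof.
rewrite /full_sv; case: insub => [e|]; first by rewrite ffunE.
by case: insub => [e|] //; rewrite ffunE; case: (X e); case: (Y e).
Qed.

Lemma full_sv_opp X i j : full_sv (sv_opp X) i j = sign_opp (full_sv X i j).
Proof.
by rewrite /full_sv; do 2?case: insub => [e|] //; rewrite ffunE.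
Qed.

Lemma full_sv_zero i j : full_sv (sv_zero (pairs n)) i j = Zero.
Proof.
by rewrite /full_sv; do 2?case: insub => [e|] //; rewrite ffunE.
Qed.

Lemma full_sv_partition I i j :
  full_sv (partition_sv I) i j = sign_cmp (block_index I i) (block_index I j).
Proof.
rewrite /full_sv; case: insubP => [e _ He|Hij].
  by rewrite ffunE He.
case: insubP => [e _ He|Hji]; first by rewrite ffunE He /= sign_cmp_opp.
have -> : i = j by apply/val_inj/eqP; rewrite eqn_leq leqNgt Hji leqNgt Hij.
by rewrite /sign_cmp ltnn.
Qed.

Lemma braid_cmp X : braid X ->
  exists p : 'I_n -> nat, forall i j, full_sv X i j = sign_cmp (p i) (p j).
Proof. by case=> I _ ->; exists (block_index I) => i j; exact: full_sv_partition. Qed.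

Lemma braid_compat X i j k : braid X ->
  compat (full_sv X i j) (full_sv X k i) (full_sv X k j).
Proof. by case/braid_cmp=> p pE; rewrite !pE compat_cmp. Qed.

Lemma braid_refl X i : braid X -> full_sv X i i = Zero.
Proof. by case/braid_cmp=> p ->; rewrite /sign_cmp ltnn. Qed.

Definition agrees X Y Z : Prop := forall i j,
  ~~ sign_sep (full_sv X i j) (full_sv Y i j) ->
  full_sv Z i j = sign_comp (full_sv X i j) (full_sv Y i j).

Lemma agreesP X Y Z :
  agrees X Y Z <-> (forall e, e \notin sv_sep X Y -> Z e = sv_comp X Y e).
Proof.
split=> [H e|H i j].
  by rewrite inE => He; rewrite -full_svE H ?full_svE ?ffunE.
rewrite /full_sv; case: insub => [e|] He.
  by rewrite H ?ffunE // inE.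
move: He; case: insub => [e|] //= He.
have Se : e \notin sv_sep X Y.
  by rewrite inE; move: He; case: (X e); case: (Y e).
by rewrite (H _ Se) ffunE; case: (X e); case: (Y e).
Qed.

Lemma full_sv_elim (M : signvec (pairs n) -> Prop) X Y i j :
    oriented_matroid M -> M X -> M Y ->
    sign_sep (full_sv X i j) (full_sv Y i j) ->
  exists Z, [/\ M Z, full_sv Z i j = Zero & agrees X Y Z].
Proof.
move=> OM MX MY; rewrite /full_sv.
case: insub => [e|] S; last move: S; first last.
  case: insub => [e|] //= S.
  have Se : e \in sv_sep X Y by rewrite inE; move: S; case: (X e); case: (Y e).
  have [Z [MZ Ze /agreesP ZXY]] := om_elim OM MX MY Se.
  by exists Z; split; rewrite ?Ze.
have Se : e \in sv_sep X Y by rewrite inE.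
by have [Z [MZ Ze /agreesP ZXY]] := om_elim OM MX MY Se; exists Z.
Qed.

Lemma agrees_compC X Y : agrees X Y (sv_comp Y X).
Proof. by move=> i j S; rewrite full_sv_comp sign_compC // sign_sepC. Qed.

Lemma agrees_compr X Y Z : agrees X Y Z -> agrees X Y (sv_comp Z X).
Proof.
move=> H i j S; rewrite full_sv_comp H //.
by case: (full_sv X i j); case: (full_sv Y i j).
Qed.

(** Off S(X, Y), the sign of Z = X o Y is never opposed to that of X, and Z o X = X o Y.
    Eliminations against [X] can therefore be iterated. *)
Lemma agrees_elim X Y Z Z' : agrees X Y Z -> agrees Z X Z' -> agrees X Y Z'.
Proof.
move=> H H' i j S; move: (H' i j); rewrite (H i j S).
by case: (full_sv X i j) S; case: (full_sv Y i j) => //= _ /(_ isT).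
Qed.

(** * Elimination of a vertex [i]; [f] and [g] are the vertex signs that accompany [X] and [Y] *)

Section VertexElimination.

Variables (M : signvec (pairs n) -> Prop) (X Y : signvec (pairs n)).
Variables (f g : 'I_n -> sign) (i : 'I_n).
Hypotheses (hM : sweep_oriented_matroid M) (MX : M X) (MY : M Y).
Hypothesis fX : forall j k, compat (full_sv X j k) (f j) (f k).
Hypothesis gY : forall j k, compat (full_sv Y j k) (g j) (g k).
Hypotheses (fi : f i = Pos) (gi : g i = Neg).

Let above j := ~~ sign_sep (f j) (g j) && (sign_comp (f j) (g j) == Pos).
Let below j := ~~ sign_sep (f j) (g j) && (sign_comp (f j) (g j) == Neg).

Let X_below j : below j -> full_sv X i j = Neg.
Proof.
by move: (fX i j); rewrite /below fi; case: full_sv => //; case: (f j); case: (g j).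
Qed.

Let Y_above j : above j -> full_sv Y i j = Pos.
Proof.
by move: (gY i j); rewrite /above gi; case: full_sv => //; case: (f j); case: (g j).
Qed.

(* Pairs from [below] to [above] do not separate X and Y. *)
Let below_above Z j k : agrees X Y Z -> below j -> above k -> full_sv Z j k = Pos.
Proof.
move=> /(_ j k); move: (fX j k) (gY j k); rewrite /below /above.
case: (f j); case: (g j) => //; case: (f k); case: (g k) => //;
  by case: (full_sv X j k) => //; case: (full_sv Y j k) => // _ _ /(_ isT).
Qed.

Let good Z := [/\ M Z, agrees X Y Z & forall k, above k -> full_sv Z i k = Pos].

Lemma repair_below_step Z j : good Z -> below j -> full_sv Z i j != Neg ->
  exists2 Z', good Z' & full_sv Z' i j = Neg /\
    forall k, below k -> full_sv Z i k = Neg -> full_sv Z' i k = Neg.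
Proof.
have [OM Mbraid] := hM; move=> [MZ ZXY Zab] jN Zij.
(* A zero at (i, j) suffices: composing with [X] turns it into - by [X_below] and keeps all nonzero
   signs. *)
suff [Z' [[MZ' Z'XY Z'ab] Z'ij Z'N]] : exists Z', [/\ good Z',
    full_sv Z' i j = Zero &
    forall k, below k -> full_sv Z i k = Neg -> full_sv Z' i k = Neg].
  exists (sv_comp Z' X); last first.
    split=> [|k kN Zk]; first by rewrite full_sv_comp Z'ij X_below.
    by rewrite full_sv_comp Z'N.
  split; [exact: om_comp | exact: agrees_compr | move=> k ka].
  by rewrite full_sv_comp Z'ab.
case ZE: (full_sv Z i j) Zij => // _; first by exists Z.
have S : sign_sep (full_sv Z i j) (full_sv X i j) by rewrite ZE X_below.
have [Z' [MZ' Z'ij Z'ZX]] := full_sv_elim OM MZ MX S.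
have Z'XY := agrees_elim ZXY Z'ZX.
exists Z'; split=> // [|k kN Zk]; last by rewrite Z'ZX Zk X_below.
(* In [Z'], [i] is in the block of [j], which precedes every vertex of [above]. *)
split=> // k ka; move: (braid_compat j k i (Mbraid _ MZ')).
by rewrite below_above // Z'ij => /eqP.
Qed.

Lemma repair_below Z : good Z ->
  exists2 Z', good Z' & forall k, below k -> full_sv Z' i k = Neg.
Proof.
have [m] := ubnP #|[set k | below k && (full_sv Z i k != Neg)]|.
elim: m Z => // m IH Z ltm gZ.
have [Z0|[j]] := set_0Vmem [set k | below k && (full_sv Z i k != Neg)].
  exists Z => // k kN; apply/eqP/negPn/negP => Zk.
  by have := in_set0 k; rewrite -Z0 inE kN Zk.
rewrite inE => /andP[jN Zj]; have [Z' gZ' [Z'j Z'N]] := repair_below_step gZ jN Zj.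
apply: IH (gZ'); rewrite ltnS in ltm; apply: leq_trans ltm.
apply/proper_card/properP; split.
  apply/subsetP=> k; rewrite !inE => /andP[kN Z'k]; rewrite kN /=.
  by apply: contra Z'k => /eqP/(Z'N k kN)->.
by exists j; rewrite !inE ?jN ?Zj ?Z'j.
Qed.

Lemma vertex_elim : exists Z, [/\ M Z, agrees X Y Z &
  forall j, ~~ sign_sep (f j) (g j) -> full_sv Z i j = sign_comp (f j) (g j)].
Proof.
have [OM Mbraid] := hM.
case: (pickP [pred j | (f j == Zero) && (g j == Zero)]) => [j /andP[fj gj]|no0].
  have Xij : full_sv X i j = Neg.
    by move: (fX i j); rewrite fi (eqP fj); case: full_sv.
  have Yij : full_sv Y i j = Pos.
    by move: (gY i j); rewrite gi (eqP gj); case: full_sv.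
  have S : sign_sep (full_sv X i j) (full_sv Y i j) by rewrite Xij Yij.
  have [Z [MZ Zij ZXY]] := full_sv_elim OM MX MY S.
  exists Z; split=> // k Sk.
  (* Since [j] has sign 0 on both sides, compatibility gives X_(j,k) = f_k and Y_(j,k) = g_k; since
     [i] and [j] share a block of [Z], Z_(i,k) = Z_(j,k). *)
  move: (fX j k) (gY j k) Sk (ZXY j k) (braid_compat j k i (Mbraid _ MZ)).
  rewrite Zij (eqP fj) (eqP gj).
  case: (full_sv X j k); case: (f k) => // _; case: (full_sv Y j k);
    by case: (g k) => // _ _ /(_ isT) ->; case: (full_sv Z i k).
(* [Y] alone may differ from X o Y where it vanishes; Y o X corrects this and keeps the signs +
   given by [Y_above]. *)
have [|Z [MZ ZXY Zab] Zbe] := @repair_below (sv_comp Y X).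
  split; [exact: om_comp | exact: agrees_compC | move=> k ka].
  by rewrite full_sv_comp Y_above.
exists Z; split=> // k Sk; move: (Zab k) (Zbe k) (no0 k) Sk.
rewrite /above /below /=.
by case: (f k); case: (g k) => //= H1 H2 _ _; rewrite ?H1 ?H2.
Qed.

End VertexElimination.

(** * Extension of partial vertex signs to a cut *)

Lemma block_index_le I i : ordered_partition I -> block_index I i <= size I.
Proof.
case/andP=> _ /and3P[/eqP cov _ _]; rewrite /block_index -has_find.
have : i \in cover [set B in I] by rewrite cov inE.
by case/bigcupP=> B; rewrite inE => BI iB; apply/hasP; exists B.
Qed.

(** The cut goes through the block of a vertex of [D] of sign 0 if there is one, and otherwise right
    after the last block that contains a vertex of [D] of sign -. *)
Lemma cut_extension I (D : {pred 'I_n}) (h : 'I_n -> sign) X :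
    ordered_partition I ->
    {in D &, forall i j,
      compat (full_sv (partition_sv I) i j) (h i) (h j)} ->
  exists2 k, 1 <= k <= (size I).*2.+1 &
    {in D, forall i, big_sv X I k (inl i) = h i}.
Proof.
move=> PI hD; set p := block_index I.
case: (pickP [pred d in D | h d == Zero]) => [d /andP[dD /eqP hd]|no0].
  exists (p d).*2.
    by rewrite double_gt0 /= leqW // leq_double block_index_le.
  move=> i iD; rewrite ffunE -/p doubleK.
  have -> : (p d).*2.-1./2 = (p d).-1 by rewrite /p /block_index doubleS /= uphalf_double.
  have := hD d i dD iD; rewrite full_sv_partition -/p hd /sign_cmp.
  have -> : (p i <= (p d).-1) = (p i < p d) by [].
  by case: ltngtP => _ //= /eqP ->.
(* If no vertex of [D] has sign -, then [c] is 0 and the cut lies before all blocks. *)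
pose c := \max_(d in D | h d == Neg) p d.
have cle : c <= size I by apply/bigmax_leqP => d _; exact: block_index_le.
exists c.*2.+1; first by rewrite /= ltnS leq_double.
move=> i iD; rewrite ffunE -/p /= doubleK uphalf_double.
case: leqP => [pic|cpi].
  have [d /andP[dD /eqP hd] pid] :
      exists2 d, (d \in D) && (h d == Neg) & p i <= p d.
    pose N := [set d | (d \in D) && (h d == Neg)].
    have cN : c = \max_(d in N) p d by apply: eq_bigl => d; rewrite inE.
    (* Blocks are numbered from 1, so [pic] rules out the empty maximum 0. *)
    have [N0|[d0 dN]] := set_0Vmem N.
      by move: pic; rewrite cN N0 big_set0.
    have [|d] := @eq_bigmax_cond _ (mem N) p; first by apply/card_gt0P; exists d0.
    by rewrite /= -cN inE => dN' cd; exists d; rewrite -?cd.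
  have := hD d i dD iD; have := no0 i; rewrite /= iD full_sv_partition -/p hd.
  by rewrite /sign_cmp ltnNge pid /=; case: ltnP => _; case: (h i).
case hi: (h i) => //; last by have := no0 i; rewrite /= iD hi.
by move: cpi; rewrite ltnNge (leq_bigmax_cond i) // iD hi.
Qed.

(** * The local description of B(M), and elimination in B(M) *)

Lemma big_omP M (Y : signvec ('I_n + pairs n)%type) :
    sweep_oriented_matroid M ->
  let X := [ffun e => Y (inr e)] in
  big_om M Y <->
  M X /\ forall i j, compat (full_sv X i j) (Y (inl i)) (Y (inl j)).
Proof.
move=> [OM Mbraid]; split=> [[X [I [k [MX PI XE /andP[k0 _] ->]]]]|[]].
  have -> : [ffun e => big_sv X I k (inr e)] = X by apply/ffunP=> e; rewrite !ffunE.
  split=> // i j; rewrite XE full_sv_partition !ffunE; apply: compat_cut.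
  by case: k {k0} => // k; rewrite succnK /= uphalf_half -add1n leq_add2r leq_b1.
set X := finfun _ => MX hY; have [I PI XE] := Mbraid _ MX.
have [|k kI Yk] := @cut_extension I predT (fun i => Y (inl i)) X PI.
  by move=> i j _ _; rewrite -XE.
exists X, I, k; split=> //; apply/ffunP=> -[i|e]; first by rewrite Yk.
by rewrite !ffunE.
Qed.

(** For pair elimination, [D] is the set of vertices outside S(X, Y): (V3) prescribes nothing at the
    others, which take whatever sign the cut gives them. *)
Lemma big_om_extend M X (D : {pred 'I_n}) (h : 'I_n -> sign) :
    sweep_oriented_matroid M -> M X ->
    {in D &, forall i j, compat (full_sv X i j) (h i) (h j)} ->
  exists Z : signvec ('I_n + pairs n)%type,
    [/\ big_om M Z, forall e, Z (inr e) = X e &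
    {in D, forall i, Z (inl i) = h i}].
Proof.
move=> [_ Mbraid] MX hD; have [I PI XE] := Mbraid _ MX.
have [|k kI Zk] := @cut_extension I D h X PI; first by rewrite -XE.
exists (big_sv X I k); split=> // [|e]; last by rewrite ffunE.
by exists X, I, k.
Qed.

Lemma big_om_vertex_elim M (X Y : signvec ('I_n + pairs n)%type) i :
    sweep_oriented_matroid M -> big_om M X -> big_om M Y ->
    X (inl i) = Pos -> Y (inl i) = Neg ->
  exists Z : signvec ('I_n + pairs n)%type, [/\ big_om M Z, Z (inl i) = Zero &
    forall e, e \notin sv_sep X Y -> Z e = sv_comp X Y e].
Proof.
move=> hM /(big_omP _ hM)[MX hX] /(big_omP _ hM)[MY hY] Xi Yi.
have [z [Mz zXY zi]] := vertex_elim hM MX MY hX hY Xi Yi.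
have bz := hM.2 _ Mz.
(* The signs z_(i,j) are the vertex signs of the cut through the block of [i]. *)
have [|Z [MZ Zz Zi]] := @big_om_extend M z predT (full_sv z i) hM Mz.
  by move=> j k _ _; exact: braid_compat.
exists Z; split=> // [|[j|e]]; first by rewrite Zi // braid_refl.
  by rewrite inE => S; rewrite Zi // zi // ffunE.
rewrite inE => S; rewrite Zz ffunE.
by have /agreesP-> := zXY; rewrite ?inE !ffunE.
Qed.

Lemma big_om_pair_elim M (X Y : signvec ('I_n + pairs n)%type) e :
    sweep_oriented_matroid M -> big_om M X -> big_om M Y ->
    inr e \in sv_sep X Y ->
  exists Z : signvec ('I_n + pairs n)%type, [/\ big_om M Z, Z (inr e) = Zero &
    forall f, f \notin sv_sep X Y -> Z f = sv_comp X Y f].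
Proof.
move=> hM /(big_omP _ hM)[MX hX] /(big_omP _ hM)[MY hY] Se.
have [|z [Mz ze zXY]] := om_elim hM.1 MX MY (e := e).
  by move: Se; rewrite !inE !ffunE.
pose D := [pred i | inl i \notin sv_sep X Y].
pose h i := sv_comp X Y (inl i).
have [|Z [MZ Zz Zi]] := @big_om_extend M z D h hM Mz.
  move=> i j; rewrite !inE /h !ffunE => Si Sj.
  by apply: compat_elim (hX i j) (hY i j) Si Sj _; apply/agreesP: i j.
exists Z; split=> // [|[i|f] S]; [by rewrite Zz | by rewrite Zi | ].
by rewrite Zz zXY; [rewrite !ffunE | move: S; rewrite !inE !ffunE].
Qed.

End FullSign.

Theorem theorem4p1 (n : nat) (M : signvec (pairs n) -> Prop)
    (hM : sweep_oriented_matroid M) :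
  oriented_matroid (big_om M).
Proof.
have [OM _] := hM; split.
- apply/(big_omP _ hM); split=> [|i j].
    by move: (om_zero OM); congr M; apply/ffunP=> e; rewrite !ffunE.
  rewrite !ffunE (_ : finfun _ = sv_zero _) ?full_sv_zero //.
  by apply/ffunP=> e; rewrite !ffunE.
- move=> X /(big_omP _ hM)[MX hX]; apply/(big_omP _ hM).
  set x := finfun _ in MX hX; set z := finfun _.
  have -> : z = sv_opp x by apply/ffunP=> e; rewrite !ffunE.
  split=> [|i j]; first exact: om_opp.
  by rewrite full_sv_opp !ffunE compat_opp.
- move=> X Y /(big_omP _ hM)[MX hX] /(big_omP _ hM)[MY hY]; apply/(big_omP _ hM).
  set x := finfun _ in MX hX; set y := finfun _ in MY hY; set z := finfun _.
  have -> : z = sv_comp x y by apply/ffunP=> e; rewrite !ffunE.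
  split=> [|i j]; first exact: om_comp.
  by rewrite full_sv_comp !ffunE; apply: compat_comp.
move=> X Y [i|e] bX bY; last exact: big_om_pair_elim.
rewrite inE => /orP[/andP[/eqP Xi /eqP Yi]|/andP[/eqP Xi /eqP Yi]].
  exact: big_om_vertex_elim.
(* Here X_i = - and Y_i = +, so [X] and [Y] are exchanged; X o Y and Y o X agree off S(X, Y). *)
have [Z [bZ Zi ZYX]] := big_om_vertex_elim hM bY bX Yi Xi.
exists Z; split=> // f; rewrite inE -/(sign_sep _ _) => S.
by rewrite ZYX ?inE -?/(sign_sep _ _) 1?sign_sepC // !ffunE [RHS]sign_compC.
Qed.
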